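(* Let $ABC$ be a triangle and $P$ a point not on the extended sides of $ABC$ or of its anticomplementary triangle. If $P$ does not lie on a median of triangle $ABC$ or on $\iota(l_\infty)$, then the generalized orthocenter $H$ of $P$ and the generalized orthocenter $H'$ of $P'$ both lie on the cevian conic $\mathcal{C}_P=ABCPQ$.
   Context: We work in the Euclidean plane extended by the line at infinity $l_\infty$. Two lines are parallel if they meet $l_\infty$ in the same point (a line is parallel to itself). Products of lines such as $AP\cdot BC$ denote intersection points. $ABC$ is a triangle with centroid $G$; $D_0,E_0,F_0$ are the midpoints of $BC,CA,AB$. $K$ is the complement map, the homothety with center $G$ and ratio $-1/2$; $K^{-1}(ABC)$ is the anticomplementary triangle. $P$ is a point (ordinary or infinite) not on the extended sides of $ABC$ or $K^{-1}(ABC)$. $D=AP\cdot BC$, $E=BP\cdot CA$, $F=CP\cdot AB$ are its traces. $D_3,E_3,F_3$ are the reflections of $D,E,F$ in $D_0,E_0,F_0$; the lines $AD_3,BE_3,CF_3$ concur in $P'=\iota(P)$, the isotomic conjugate of $P$ (in barycentric coordinates $\iota(x:y:z)=(1/x:1/y:1/z)$). $\iota(l_\infty)$ is the Steiner circumellipse. $Q=K(P')$, $Q'=K(P)$. The medians are the lines $AG,BG,CG$. The generalized orthocenter $H$ of $P$ is the point lying on the lines through $A,B,C$ parallel respectively to $QD,QE,QF$ (these lines are concurrent). $H'$ is the corresponding point for $P'$, i.e. the point on the lines through $A,B,C$ parallel respectively to $Q'D_3,Q'E_3,Q'F_3$. If $P$ is not on a median, $\mathcal{C}_P=ABCPQ$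 is the unique (nondegenerate) conic through $A,B,C,P,Q$. *)

(* Defs.v *)
From mathcomp Require Import all_boot all_order all_algebra.

Set Implicit Arguments.
Unset Strict Implicit.
Unset Printing Implicit Defensive.

Import Order.TTheory GRing.Theory Num.Theory.
Local Open Scope ring_scope.

(* The plane R^2 extended by the line at infinity, in homogeneous coordinates:
   a point is a nonzero row vector (X0, X1, X2) up to a nonzero scalar, a line
   is a nonzero row vector of coefficients up to a nonzero scalar, and an
   ordinary point (x, y) is represented by (x, y, 1).  All the constructions
   below are compatible with rescaling of the representatives.               *)

Section ExtendedPlane.
Variable R : realFieldType.
Implicit Types (a b c : 'rV[R]_2) (u v X Y P Q l m : 'rV[R]_3).

Definition pt a : 'rV[R]_3 := row_mx a (1%:M : 'M_1).

Definition linf : 'rV[R]_3 := delta_mx 0 ord_max.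

Definition on X l : bool := \sum_i X 0 i * l 0 i == 0.

(* The indices are added modulo 3. *)
Definition cross u v : 'rV[R]_3 :=
  \row_i (u 0 (i + 1) * v 0 (i + 2%:R) - u 0 (i + 2%:R) * v 0 (i + 1)).

(* Meaningful for two distinct points, resp. two distinct lines; the value is
   the zero vector (which is neither a point nor a line) otherwise.          *)
Definition join X Y := cross X Y.
Definition meet l m := cross l m.

Definition same_point X Y : bool := (X == Y)%MS.

Definition parallel_through X l := join X (meet l linf).

(* On ordinary points this is x |-> g + k (x - g); for k != 0 every point at
   infinity is fixed.                                                        *)
Definition homothety (g : 'rV[R]_2) (k : R) X : 'rV[R]_3 :=
  k *: X + ((1 - k) * X 0 ord_max) *: pt g.

Definition reflection (g : 'rV[R]_2) X := homothety g (-1) X.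

(* If a = b then join (pt a) (pt b) = 0, so degenerate pairs are excluded.   *)
Definition triangle a b c : bool := ~~ on (pt c) (join (pt a) (pt b)).

Definition midpoint a b : 'rV[R]_2 := 2^-1 *: (a + b).
Definition centroid a b c : 'rV[R]_2 := 3^-1 *: (a + b + c).

Definition off_sides X Y Z P : bool :=
  [&& ~~ on P (join Y Z), ~~ on P (join Z X) & ~~ on P (join X Y)].

Section Triangle.
Variables A B C : 'rV[R]_2.

Definition complement := homothety (centroid A B C) (- 2^-1).
Definition anticomplement := homothety (centroid A B C) (- 2).

Definition off_triangle P : bool := off_sides (pt A) (pt B) (pt C) P.
Definition off_anticomplementary P : bool :=
  off_sides (anticomplement (pt A)) (anticomplement (pt B))
            (anticomplement (pt C)) P.

Definition on_median P : bool :=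
  [|| on P (join (pt A) (pt (centroid A B C))),
      on P (join (pt B) (pt (centroid A B C)))
    | on P (join (pt C) (pt (centroid A B C)))].

Definition traceA P := meet (join (pt A) P) (join (pt B) (pt C)).
Definition traceB P := meet (join (pt B) P) (join (pt C) (pt A)).
Definition traceC P := meet (join (pt C) P) (join (pt A) (pt B)).

Definition trace3A P := reflection (midpoint B C) (traceA P).
Definition trace3B P := reflection (midpoint C A) (traceB P).
Definition trace3C P := reflection (midpoint A B) (traceC P).

(* For P off the sides the two lines are distinct, and by Ceva's theorem the
   line join (pt C) (trace3C P) passes through their intersection: in
   barycentric coordinates this is (x : y : z) |-> (1/x : 1/y : 1/z).        *)
Definition isotomic P :=
  meet (join (pt A) (trace3A P)) (join (pt B) (trace3B P)).

(* P lies on the image of the line at infinity under the isotomic map. *)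
Definition on_steiner P : Prop :=
  exists X, [/\ X != 0, on X linf, off_triangle X
              & same_point P (isotomic X)].

Definition cevian_Q P := complement (isotomic P).

(* The three lines are concurrent and not all equal, so that H is unique up to
   a scalar. Two of them may coincide (H may be a vertex), hence a statement
   by incidence with all three.                                              *)
Definition generalized_orthocenter P H : Prop :=
  [/\ H != 0,
      on H (parallel_through (pt A) (join (cevian_Q P) (traceA P))),
      on H (parallel_through (pt B) (join (cevian_Q P) (traceB P)))
    & on H (parallel_through (pt C) (join (cevian_Q P) (traceC P)))].

End Triangle.

(* The symmetric matrix M represents the conic X M X^T = 0, which is
   nondegenerate when M is invertible.                                       *)
Definition on_conic X (M : 'M[R]_3) : bool := (X *m M *m X^T) 0 0 == 0.

Definition nondegenerate_conic (M : 'M[R]_3) : bool :=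
  (M^T == M) && (M \in unitmx).

Definition cevian_conic A B C P (M : 'M[R]_3) : Prop :=
  nondegenerate_conic M /\
  [/\ on_conic (pt A) M, on_conic (pt B) M, on_conic (pt C) M,
      on_conic P M & on_conic (cevian_Q A B C P) M].

End ExtendedPlane.

(* Main.v *)
(** In barycentric coordinates P = (x : y : z), put s = xy + yz + zx.  Then
    P' = (1/x : 1/y : 1/z), Q = (x(y+z) : y(z+x) : z(x+y)) and
    H = (x/(s - x^2) : y/(s - y^2) : z/(s - z^2)).  The isotomic map sends conics
    through A, B, C to lines, and P, Q, H to (1/x), (s/x + x), (s/x - x)
    (first coordinates, the others by symmetry), which are visibly collinear.
    Passing to P' exchanges x and 1/x, so the image of H' lies on the same line,
    the span of (1/x) and (x).                                               *)

Require Import Defs.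
From mathcomp Require Import all_boot all_order all_algebra.
From mathcomp Require Import ring.

Set Implicit Arguments.
Unset Strict Implicit.
Unset Printing Implicit Defensive.

Import GRing.Theory Num.Theory.
Local Open Scope ring_scope.

(** * Triple products, coordinates in a basis, and bilinear forms on triples *)

Section Vectors.
Variable R : realFieldType.
Implicit Types (u v w l X Y Z : 'rV[R]_3) (x y z k : R) (M : 'M[R]_3).

Definition dot X l : R := \sum_i X 0 i * l 0 i.

(** The determinant of the rows [u], [v], [w]; for points, it vanishes exactly when they are
    collinear. *)
Definition vol u v w : R := dot u (cross v w).

(** Coordinates of vectors, neither normalised nor taken up to scale: constructions then become
    equations that [ring] and [field] can check. *)
Definition bary u v w x y z : 'rV[R]_3 := x *: u + y *: v + z *: w.

Lemma on_joinE X u v : on X (join u v) = (vol X u v == 0). Proof. by []. Qed.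

Lemma ord3P (Pr : 'I_3 -> Prop) : Pr 0 -> Pr 1 -> Pr ord_max -> forall i, Pr i.
Proof.
move=> P0 P1 P2 [[|[|[|//]]] i3].
- by rewrite (_ : Ordinal i3 = 0) //; apply: val_inj.
- by rewrite (_ : Ordinal i3 = 1) //; apply: val_inj.
- by rewrite (_ : Ordinal i3 = ord_max) //; apply: val_inj.
Qed.

Lemma dotE u v :
  dot u v = u 0 0 * v 0 0 + u 0 1 * v 0 1 + u 0 ord_max * v 0 ord_max.
Proof.
rewrite /dot !big_ord_recl big_ord0 addr0 addrA.
by congr (_ + _ * _ + _ * _); congr (_ _ _); apply: val_inj.
Qed.

Lemma cross0 u v : cross u v 0 0 = u 0 1 * v 0 ord_max - u 0 ord_max * v 0 1.
Proof.
by rewrite mxE; congr (_ * _ - _ * _); congr (_ _ _); apply: val_inj.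
Qed.

Lemma cross1 u v : cross u v 0 1 = u 0 ord_max * v 0 0 - u 0 0 * v 0 ord_max.
Proof.
by rewrite mxE; congr (_ * _ - _ * _); congr (_ _ _); apply: val_inj.
Qed.

Lemma cross2 u v : cross u v 0 ord_max = u 0 0 * v 0 1 - u 0 1 * v 0 0.
Proof.
by rewrite mxE; congr (_ * _ - _ * _); congr (_ _ _); apply: val_inj.
Qed.

(** The double cross product identity. It writes a meet as a combination of the two points joined,
    so barycentric coordinates pass to it directly. *)
Lemma meet_join u v l : meet (join u v) l = dot u l *: v - dot v l *: u.
Proof.
apply/rowP; apply: ord3P;
  rewrite ?(cross0, cross1, cross2) 4!mxE !dotE; ring.
Qed.

Lemma dot_linf X : dot X (linf R) = X 0 ord_max.
Proof.
rewrite /dot (bigD1 ord_max) //= big1 ?addr0 ?mxE ?eqxx ?mulr1 // => i.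
by move=> /negPf ni; rewrite mxE ni andbF mulr0.
Qed.

Definition det3 x1 y1 z1 x2 y2 z2 x3 y3 z3 : R :=
  x1 * (y2 * z3 - z2 * y3) + y1 * (z2 * x3 - x2 * z3)
  + z1 * (x2 * y3 - y2 * x3).

(** Multiplicativity of the determinant. *)
Lemma vol_bary u v w X Y Z x1 y1 z1 x2 y2 z2 x3 y3 z3 :
  X = bary u v w x1 y1 z1 -> Y = bary u v w x2 y2 z2 ->
  Z = bary u v w x3 y3 z3 ->
  vol X Y Z = det3 x1 y1 z1 x2 y2 z2 x3 y3 z3 * vol u v w.
Proof.
move=> -> -> ->; rewrite /det3 /vol !dotE !(cross0, cross1, cross2) !mxE; ring.
Qed.

(** Cramer's rule. *)
Lemma bary_exists u v w X : vol u v w != 0 ->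
  exists x y z, X = bary u v w x y z.
Proof.
move=> d0; exists (vol X v w / vol u v w), (vol u X w / vol u v w),
  (vol u v X / vol u v w).
have VK a c : vol u v w * (a / vol u v w * c) = a * c.
  by rewrite mulrA mulrCA mulfV // mulr1.
apply: (scalerI d0); apply/rowP => i; rewrite !mxE !mulrDr !VK {d0 VK}.
move: i; apply: ord3P; rewrite /vol !dotE !(cross0, cross1, cross2); ring.
Qed.

Lemma baryE u v w x y z i :
  bary u v w x y z 0 i = x * u 0 i + y * v 0 i + z * w 0 i.
Proof. by rewrite !mxE. Qed.

Lemma scale_bary u v w k x y z :
  k *: bary u v w x y z = bary u v w (k * x) (k * y) (k * z).
Proof. by rewrite /bary !scalerDr !scalerA. Qed.

Lemma add_bary u v w x1 y1 z1 x2 y2 z2 :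
  bary u v w x1 y1 z1 + bary u v w x2 y2 z2 =
  bary u v w (x1 + x2) (y1 + y2) (z1 + z2).
Proof. by rewrite /bary !scalerDl addrACA; congr (_ + _); rewrite addrACA. Qed.

Lemma bary100 u v w : u = bary u v w 1 0 0.
Proof. by rewrite /bary !scale0r !addr0 scale1r. Qed.
Lemma bary010 u v w : v = bary u v w 0 1 0.
Proof. by rewrite /bary !scale0r addr0 add0r scale1r. Qed.
Lemma bary001 u v w : w = bary u v w 0 0 1.
Proof. by rewrite /bary !scale0r !add0r scale1r. Qed.

Definition form M u v : R := (u *m M *m v^T) 0 0.

Lemma on_conicE X M : on_conic X M = (form M X X == 0). Proof. by []. Qed.

(** When [u], [v], [w] lie on the conic, only the three mixed coefficients survive. *)
Lemma form_bary M u v w x y z :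
  let b := bary u v w x y z in
  form M b b = x ^+ 2 * form M u u + y ^+ 2 * form M v v + z ^+ 2 * form M w w
    + y * z * (form M v w + form M w v) + z * x * (form M w u + form M u w)
    + x * y * (form M u v + form M v u).
Proof.
rewrite /form /bary /= !linearD /= !linearZ /= !mulmxDl -!scalemxAl.
move: (u *m M) (v *m M) (w *m M) => U V W.
rewrite !mxE; ring.
Qed.

End Vectors.

(** * Barycentric coordinates with respect to the triangle *)

Section Plane.
Variables (R : realFieldType) (A B C : 'rV[R]_2).
Hypothesis hABC : triangle A B C.
Implicit Types (x y z : R).

Notation b := (bary (pt A) (pt B) (pt C)).
Notation Delta := (vol (pt A) (pt B) (pt C)).

Let eA : pt A = b 1 0 0 := bary100 _ _ _.
Let eB : pt B = b 0 1 0 := bary010 _ _ _.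
Let eC : pt C = b 0 0 1 := bary001 _ _ _.

Let two0 : (2 : R) != 0. Proof. by rewrite pnatr_eq0. Qed.
Let three0 : (3 : R) != 0. Proof. by rewrite pnatr_eq0. Qed.

Lemma pt_max (a : 'rV[R]_2) : pt a 0 ord_max = 1.
Proof.
have := row_mxEr a (1%:M : 'M_1) 0 0; rewrite [RHS]mxE eqxx mulr1n => <-.
by congr (row_mx _ _ _ _); apply: val_inj.
Qed.

Lemma bary_max x y z : b x y z 0 ord_max = x + y + z.
Proof. by rewrite baryE !pt_max !mulr1. Qed.

Lemma Delta_neq0 : Delta != 0.
Proof.
move: hABC; rewrite /triangle on_joinE (vol_bary eC eA eB).
by rewrite (_ : _ * Delta = Delta) // /det3; ring.
Qed.

Lemma pt_comb (a c d : 'rV[R]_2) k l m : k + l + m = 1 ->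
  pt (k *: a + l *: c + m *: d) = bary (pt a) (pt c) (pt d) k l m.
Proof.
move=> klm; pose e : 'M[R]_1 := 1%:M; rewrite /bary /pt.
change (row_mx (k *: a + l *: c + m *: d) e =
  k *: row_mx a e + l *: row_mx c e + m *: row_mx d e).
by rewrite !scale_row_mx !add_row_mx -!scalerDl klm scale1r.
Qed.

Lemma pt_midpoint (a c : 'rV[R]_2) : pt (midpoint a c) = 2^-1 *: (pt a + pt c).
Proof.
(* A third point of weight 0 is added to fit [pt_comb]. *)
have -> : midpoint a c = 2^-1 *: a + 2^-1 *: c + 0 *: a.
  by rewrite scale0r addr0 -scalerDr.
by rewrite pt_comb ?/bary ?scale0r ?addr0 ?scalerDr //; field.
Qed.

Lemma pt_centroid : pt (centroid A B C) = b 3^-1 3^-1 3^-1.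
Proof.
have -> : centroid A B C = 3^-1 *: A + 3^-1 *: B + 3^-1 *: C.
  by rewrite -!scalerDr.
by rewrite pt_comb //; field.
Qed.

Lemma complement_bary x y z :
  complement A B C (b x y z) =
  b (2^-1 * (y + z)) (2^-1 * (z + x)) (2^-1 * (x + y)).
Proof.
rewrite /complement /homothety bary_max pt_centroid !scale_bary add_bary.
by congr bary; field.
Qed.

Lemma anticomplement_bary x y z :
  anticomplement A B C (b x y z) = b (y + z - x) (z + x - y) (x + y - z).
Proof.
rewrite /anticomplement /homothety bary_max pt_centroid !scale_bary add_bary.
by congr bary; field.
Qed.

Lemma reflection_bary (g : 'rV[R]_2) g0 g1 g2 x y z :
  pt g = b g0 g1 g2 -> let s := 2 * (x + y + z) in
  reflection g (b x y z) = b (s * g0 - x) (s * g1 - y) (s * g2 - z).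
Proof.
move=> eg s; rewrite /reflection /homothety bary_max eg !scale_bary add_bary /s.
by congr bary; ring.
Qed.

Lemma on_bary X Y Z x1 y1 z1 x2 y2 z2 x3 y3 z3 :
  X = b x1 y1 z1 -> Y = b x2 y2 z2 -> Z = b x3 y3 z3 ->
  on X (join Y Z) = (det3 x1 y1 z1 x2 y2 z2 x3 y3 z3 == 0).
Proof.
move=> eX eY eZ.
by rewrite on_joinE (vol_bary eX eY eZ) mulf_eq0 (negPf Delta_neq0) orbF.
Qed.

Lemma meet_bary X Y Z W x1 y1 z1 x2 y2 z2 x3 y3 z3 x4 y4 z4 :
  X = b x1 y1 z1 -> Y = b x2 y2 z2 -> Z = b x3 y3 z3 -> W = b x4 y4 z4 ->
  let p := det3 x1 y1 z1 x3 y3 z3 x4 y4 z4 * Delta in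
  let q := det3 x2 y2 z2 x3 y3 z3 x4 y4 z4 * Delta in
  meet (join X Y) (join Z W) =
  b (p * x2 - q * x1) (p * y2 - q * y1) (p * z2 - q * z1).
Proof.
move=> eX eY eZ eW p q; rewrite meet_join.
have -> : dot X (join Z W) = p by exact: vol_bary.
have -> : dot Y (join Z W) = q by exact: vol_bary.
rewrite eX eY -scaleNr !scale_bary add_bary.
by congr bary; ring.
Qed.

Lemma off_triangle_bary x y z :
  off_triangle A B C (b x y z) = [&& x != 0, y != 0 & z != 0].
Proof.
rewrite /off_triangle /off_sides (on_bary erefl eB eC) (on_bary erefl eC eA).
rewrite (on_bary erefl eA eB).
by congr (_ && (_ && _)); congr (~~ (_ == 0)); rewrite /det3; ring.
Qed.

(** The side of the anticomplementary triangle through A has equation y + z = 0; the determinant is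
    twice this sum. *)
Lemma off_anticomplementary_bary x y z :
  off_anticomplementary A B C (b x y z) ->
  [&& y + z != 0, z + x != 0 & x + y != 0].
Proof.
rewrite /off_anticomplementary /off_sides.
have aE X x' y' z' (e : X = b x' y' z') := etrans
  (congr1 (anticomplement A B C) e) (anticomplement_bary x' y' z').
rewrite (on_bary erefl (aE _ _ _ _ eB) (aE _ _ _ _ eC)).
rewrite (on_bary erefl (aE _ _ _ _ eC) (aE _ _ _ _ eA)).
rewrite (on_bary erefl (aE _ _ _ _ eA) (aE _ _ _ _ eB)) /det3.
have dE (t t' : R) : t = 2 * t' -> t != 0 -> t' != 0.
  by move=> ->; rewrite mulf_eq0 (negPf two0).
case/and3P=> hA hB hC; apply/and3P.
by split; [move: hA | move: hB | move: hC]; apply: dE; ring.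
Qed.

(** The median from A has equation y = z. *)
Lemma off_median_bary x y z :
  ~~ on_median A B C (b x y z) -> [&& y != z, z != x & x != y].
Proof.
rewrite /on_median (on_bary erefl eA pt_centroid) (on_bary erefl eB pt_centroid).
rewrite (on_bary erefl eC pt_centroid) !negb_or /det3.
have dE (t p q : R) : t = 3^-1 * (q - p) -> t != 0 -> p != q.
  by move=> ->; rewrite mulf_eq0 invr_eq0 (negPf three0) subr_eq0 eq_sym.
case/and3P=> hA hB hC; apply/and3P.
by split; [move: hA | move: hB | move: hC]; apply: dE; ring.
Qed.

(** * Coordinates of the traces, P', Q and the equations of H *)

Lemma traceA_bary x y z :
  traceA A B C (b x y z) = b 0 (Delta * y) (Delta * z).
Proof.
by rewrite /traceA (meet_bary eA erefl eB eC) /det3; congr bary; ring.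
Qed.

Lemma traceB_bary x y z :
  traceB A B C (b x y z) = b (Delta * x) 0 (Delta * z).
Proof.
by rewrite /traceB (meet_bary eB erefl eC eA) /det3; congr bary; ring.
Qed.

Lemma traceC_bary x y z :
  traceC A B C (b x y z) = b (Delta * x) (Delta * y) 0.
Proof.
by rewrite /traceC (meet_bary eC erefl eA eB) /det3; congr bary; ring.
Qed.

(** On BC, reflection in the midpoint swaps the last two coordinates. *)
Lemma trace3A_bary x y z :
  trace3A A B C (b x y z) = b 0 (Delta * z) (Delta * y).
Proof.
have em : pt (midpoint B C) = b 0 2^-1 2^-1.
  rewrite pt_midpoint [X in X + _]eB [X in _ + X]eC add_bary scale_bary.
  by congr bary; ring.
rewrite /trace3A traceA_bary (reflection_bary _ _ _ em).
by congr bary; field.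
Qed.

Lemma trace3B_bary x y z :
  trace3B A B C (b x y z) = b (Delta * z) 0 (Delta * x).
Proof.
have em : pt (midpoint C A) = b 2^-1 0 2^-1.
  rewrite pt_midpoint [X in X + _]eC [X in _ + X]eA add_bary scale_bary.
  by congr bary; ring.
rewrite /trace3B traceB_bary (reflection_bary _ _ _ em).
by congr bary; field.
Qed.

(** This is (1/x : 1/y : 1/z) cleared of denominators. Each of the two reflected traces contributes
    a factor [Delta], and the meet a third. *)
Lemma isotomic_bary x y z : let k := Delta ^+ 3 in
  isotomic A B C (b x y z) = b (k * (y * z)) (k * (z * x)) (k * (x * y)).
Proof.
rewrite /isotomic (meet_bary eA (trace3A_bary _ _ _) eB (trace3B_bary _ _ _)).
by rewrite /det3; congr bary; ring.
Qed.

Lemma cevian_Q_bary x y z : let k := Delta ^+ 3 / 2 in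
  cevian_Q A B C (b x y z) =
  b (k * (x * (y + z))) (k * (y * (z + x))) (k * (z * (x + y))).
Proof.
by rewrite /cevian_Q isotomic_bary complement_bary; congr bary; field.
Qed.

(** The point at infinity of ZW is p W - q Z, whose coordinate sum is p q - q p = 0. *)
Lemma on_parallel_bary X Y Z W h0 h1 h2 x1 y1 z1 x2 y2 z2 x3 y3 z3 :
  X = b h0 h1 h2 -> Y = b x1 y1 z1 -> Z = b x2 y2 z2 -> W = b x3 y3 z3 ->
  let p := x2 + y2 + z2 in let q := x3 + y3 + z3 in
  on X (parallel_through Y (join Z W)) =
  (det3 h0 h1 h2 x1 y1 z1
        (p * x3 - q * x2) (p * y3 - q * y2) (p * z3 - q * z2) == 0).
Proof.
move=> eX eY eZ eW p q; apply: on_bary => //.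
rewrite meet_join !dot_linf eZ eW !bary_max -scaleNr !scale_bary add_bary.
by congr bary; rewrite /p /q; ring.
Qed.

(** Each incidence gives one equation; s - z^2 arises as 2s - (y+z)(z+x), because (y+z)(z+x) = s +
    z^2. The ratios are cross-multiplied because such a factor may vanish. *)
Lemma generalized_orthocenter_bary x y z h0 h1 h2 :
  generalized_orthocenter A B C (b x y z) (b h0 h1 h2) ->
  let s := x * y + y * z + z * x in
  [/\ h1 * z * (s - y ^+ 2) = h2 * y * (s - z ^+ 2),
      h2 * x * (s - z ^+ 2) = h0 * z * (s - x ^+ 2)
    & h0 * y * (s - x ^+ 2) = h1 * x * (s - y ^+ 2)].
Proof.
move=> hO s; case: hO => _.
rewrite (on_parallel_bary erefl eA (cevian_Q_bary _ _ _) (traceA_bary _ _ _)).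
rewrite (on_parallel_bary erefl eB (cevian_Q_bary _ _ _) (traceB_bary _ _ _)).
rewrite (on_parallel_bary erefl eC (cevian_Q_bary _ _ _) (traceC_bary _ _ _)).
have k0 : Delta ^+ 4 / 2 != 0.
  by rewrite mulf_neq0 ?invr_eq0 ?expf_neq0 ?Delta_neq0.
have dE (t p q : R) : t = Delta ^+ 4 / 2 * (q - p) -> t == 0 -> p = q.
  by move=> ->; rewrite mulf_eq0 (negPf k0) subr_eq0 => /eqP.
by rewrite /det3 => hA hB hC; split; [move: hA|move: hB|move: hC];
  apply: dE; rewrite /s; field.
Qed.

End Plane.

(** * Circumconics through P and P', and the theorem *)

(* p, q, r are the off-diagonal coefficients of a circumconic in barycentric
   coordinates: the first hypothesis says that (x : y : z) lies on it, the
   second that its isotomic conjugate does.                                  *)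
Lemma circumconic_orthocenter (R : realFieldType) (p q r x y z h0 h1 h2 : R) :
  let s := x * y + y * z + z * x in
  [&& x != 0, y != 0 & z != 0] ->
  [&& y + z != 0, z + x != 0 & x + y != 0] ->
  [&& y != z, z != x & x != y] ->
  p * (y * z) + q * (z * x) + r * (x * y) = 0 ->
  p * x + q * y + r * z = 0 ->
  [/\ h1 * z * (s - y ^+ 2) = h2 * y * (s - z ^+ 2),
      h2 * x * (s - z ^+ 2) = h0 * z * (s - x ^+ 2)
    & h0 * y * (s - x ^+ 2) = h1 * x * (s - y ^+ 2)] ->
  p * (h1 * h2) + q * (h2 * h0) + r * (h0 * h1) = 0.
Proof.
move=> s /and3P[x0 y0 z0] /and3P[yz zx xy] /and3P[nyz nzx nxy] e1 e2 [].
(* The numbers s - x^2, s - y^2, s - z^2 are pairwise distinct, so at most one of them is zero. *)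
have sq_neq t t' : t + t' != 0 -> t != t' -> s - t ^+ 2 != s - t' ^+ 2.
  move=> s0 d0; rewrite -subr_eq0 (_ : _ - _ = (t + t') * (t' - t)); last by ring.
  by rewrite mulf_neq0 // subr_eq0 eq_sym.
have := sq_neq _ _ yz nyz; have := sq_neq _ _ zx nzx; have := sq_neq _ _ xy nxy.
(* Collinearity of the isotomic images, times x y z: the triple (s/x - x) is s times (1/x) minus
   (x), and [e1], [e2] put both on the line (p : q : r). *)
have : p * (y * z) * (s - x ^+ 2) + q * (z * x) * (s - y ^+ 2)
       + r * (x * y) * (s - z ^+ 2) = 0.
  have -> : p * (y * z) * (s - x ^+ 2) + q * (z * x) * (s - y ^+ 2)
       + r * (x * y) * (s - z ^+ 2) =
    s * (p * (y * z) + q * (z * x) + r * (x * y))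
    - x * y * z * (p * x + q * y + r * z) by ring.
  by rewrite e1 e2 !mulr0 subrr.
move: (s - x ^+ 2) (s - y ^+ 2) (s - z ^+ 2) => a c d e nac nda ncd fA fB fC.
have zero (t k l : R) : k != 0 -> l != 0 -> t * k * l = 0 -> t = 0.
  by move=> k0 l0 /eqP; rewrite !mulf_eq0 (negPf k0) (negPf l0) !orbF => /eqP.
(* If one factor vanishes, the other two do not, and H is forced to be a vertex. *)
have [a0 | a0] := eqVneq a 0.
  rewrite a0 in nac nda fB fC.
  have -> : h1 = 0 by apply: (zero _ x c); rewrite // 1?eq_sym // -fC mulr0.
  have -> : h2 = 0 by apply: (zero _ x d); rewrite // fB mulr0.
  by rewrite !(mul0r, mulr0, addr0).
have [c0 | c0] := eqVneq c 0.
  rewrite c0 in ncd fA fC.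
  have -> : h0 = 0 by apply: (zero _ y a); rewrite // fC mulr0.
  have -> : h2 = 0 by apply: (zero _ y d); rewrite // 1?eq_sym // -fA mulr0.
  by rewrite !(mul0r, mulr0, addr0).
have [d0 | d0] := eqVneq d 0.
  rewrite d0 in fA fB.
  have -> : h0 = 0 by apply: (zero _ z a); rewrite // -fB mulr0.
  have -> : h1 = 0 by apply: (zero _ z c); rewrite // fA mulr0.
  by rewrite !(mul0r, mulr0, addr0).
(* All factors are now nonzero, so H is determined by [h0], and the conic equation becomes a
   multiple of [e]. *)
have -> : h1 = h0 * y * a / (x * c).
  by rewrite fC; field; rewrite c0 x0.
have -> : h2 = h0 * z * a / (x * d).
  by rewrite -fB; field; rewrite d0 x0.
transitivity (h0 ^+ 2 * a / (x ^+ 2 * c * d)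
  * (p * (y * z) * a + q * (z * x) * c + r * (x * y) * d)).
  by field; rewrite c0 d0 x0.
by rewrite e mulr0.
Qed.

Theorem theorem2p8 (R : realFieldType) (A B C : 'rV[R]_2)
    (hABC : triangle A B C) (P : 'rV[R]_3) (hP : P != 0%R)
    (hside : off_triangle A B C P)
    (hanti : off_anticomplementary A B C P)
    (hmed : ~~ on_median A B C P)
    (hst : ~ on_steiner A B C P)
    (H H' : 'rV[R]_3)
    (hH : generalized_orthocenter A B C P H)
    (hH' : generalized_orthocenter A B C (isotomic A B C P) H')
    (Gamma : 'M[R]_3) (hGamma : cevian_conic A B C P Gamma) :
  on_conic H Gamma /\ on_conic H' Gamma.
Proof.
have d0 := Delta_neq0 hABC.
have [x [y [z eP]]] := bary_exists P d0; subst P.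
have [h0 [h1 [h2 eH]]] := bary_exists H d0; subst H.
have [h0' [h1' [h2' eH']]] := bary_exists H' d0; subst H'.
move: hside hanti hmed; rewrite (off_triangle_bary hABC).
move=> hside /(off_anticomplementary_bary hABC) hanti.
move=> /(off_median_bary hABC) hmed.
have [/and3P[x0 y0 z0] /and3P[yz zx xy]] := (hside, hanti).
have /and3P[nyz nzx nxy] := hmed.
have k0 : vol (pt A) (pt B) (pt C) ^+ 3 != 0 by rewrite expf_neq0.
case: hGamma => _ []; rewrite !on_conicE cevian_Q_bary.
move=> /eqP cA /eqP cB /eqP cC.
(* The vertices lie on the conic, so the square terms vanish; the mixed coefficients are then
   abstracted as p, q, r. *)
rewrite !form_bary cA cB cC !mulr0 !add0r.
move: (_ + form _ (pt C) (pt B)) (_ + form _ (pt A) (pt C)).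
move: (_ + form _ (pt B) (pt A)) => r p q /eqP eP /eqP eQ.
have e1 : p * (y * z) + q * (z * x) + r * (x * y) = 0 by rewrite -[RHS]eP; ring.
have e2 : p * x + q * y + r * z = 0.
  move: eQ; set k := _ / 2 => eQ.
  have c0 : k ^+ 2 * (x * y * z) != 0.
    by rewrite !mulf_neq0 ?expf_neq0 ?mulf_neq0 ?invr_eq0 ?pnatr_eq0.
  (* Since (z+x)(x+y) = s + x^2, the equation at Q splits into a multiple of the equation at P and a
     multiple of p x + q y + r z. *)
  pose s := x * y + y * z + z * x.
  have {}eQ : k ^+ 2 * (x * y * z) * (p * x + q * y + r * z)
      + k ^+ 2 * s * (p * (y * z) + q * (z * x) + r * (x * y)) = 0.
    by rewrite -[RHS]eQ /s; ring.
  by apply: (mulfI c0); rewrite e1 mulr0 addr0 in eQ; rewrite mulr0.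
have conicE g0 g1 g2 : p * (g1 * g2) + q * (g2 * g0) + r * (g0 * g1) = 0 ->
    g1 * g2 * p + g2 * g0 * q + g0 * g1 * r == 0.
  by move=> e; apply/eqP; rewrite -[RHS]e; ring.
split; apply: conicE.
  exact: circumconic_orthocenter (generalized_orthocenter_bary hABC hH).
(* For H' the same lemma is applied to P' = k (yz : zx : xy): up to nonzero factors, [e1] and [e2]
   exchange roles. *)
move: hH'; rewrite isotomic_bary.
move: (_ ^+ 3) k0 => k k0 /(generalized_orthocenter_bary hABC).
apply: circumconic_orthocenter.
- by rewrite !mulf_neq0.
(* Here k z x + k x y = k x (y + z); the differences below factor likewise. *)
- have addE (t u v w : R) : t != 0 -> u + v != 0 -> w = k * t * (u + v) -> w != 0.
    by move=> t0 uv ->; rewrite !mulf_neq0.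
  apply/and3P; split; [apply: (addE x y z)|apply: (addE y z x)|
    apply: (addE z x y)]; by [|ring].
- have subE (t u v w w' : R) : t != 0 -> u != v -> w - w' = k * t * (v - u) ->
      w != w'.
    by move=> t0 uv e; rewrite -subr_eq0 e !mulf_neq0 // subr_eq0 eq_sym.
  apply/and3P; split; [apply: (subE x y z)|apply: (subE y z x)|
    apply: (subE z x y)]; by [|ring].
- by rewrite -[RHS](mulr0 (k ^+ 2 * (x * y * z))) -e2; ring.
- by rewrite -[RHS](mulr0 k) -e1; ring.
Qed.
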